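(* We have $\mathcal{D} = \mathcal{D}_0 \sqcup (2,+\infty]$, where $\sqcup$ denotes a disjoint union.
   Context: Alphabets are arbitrary sets $\mathcal{A}$ (finite or infinite, disjoint from $\mathbb{N}^*=\{1,2,3,\dots\}$); infinite words are right-infinite sequences of letters. The empty word $\varepsilon$ counts as a palindrome and as a prefix of every word. For an infinite word $w$ with infinitely many palindromic prefixes, let $(n_i)_{i\ge1}$ be the increasing sequence of the lengths of all its palindromic prefixes ($n_1=0$), and set $\delta(w)=\limsup_{i\to\infty} n_{i+1}/n_i$; if $w$ has only finitely many palindromic prefixes, set $\delta(w)=\infty$. An infinite word $w$ has abundant palindromic prefixes if it has infinitely many palindromic prefixes and $n_{i+1}\le 2n_i+1$ for all $i\ge1$. $\mathcal{D}$ is the set of all values $\delta(w)$ as $w$ ranges over infinite words on arbitrary alphabets, and $\mathcal{D}_0$ is the set of values $\delta(w)$ as $w$ ranges over infinite words with abundant palindromic prefixes. *)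

(* Defs.v *)
From mathcomp Require Import all_boot all_order all_algebra.
From mathcomp Require Import all_classical all_reals all_analysis.
Set Implicit Arguments. Unset Strict Implicit. Unset Printing Implicit Defensive.
Import Order.TTheory GRing.Theory Num.Theory.
Local Open Scope classical_set_scope.
Local Open Scope ring_scope.

(* Infinite words over an arbitrary alphabet A are maps nat -> A (indices from 0). *)

Definition pal_prefix (A : Type) (w : nat -> A) (m : nat) : Prop :=
  forall k, (k < m)%N -> w k = w (m.-1 - k)%N.

Definition inf_pal_prefixes (A : Type) (w : nat -> A) : Prop :=
  forall N, exists m, (N <= m)%N /\ pal_prefix w m.

(* n enumerates (0-indexed: n 0 = n_1) the lengths of all palindromic
   prefixes of w in increasing order. *)
Definition pal_enum (A : Type) (w : nat -> A) (n : nat -> nat) : Prop :=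
  (forall i, (n i < n i.+1)%N) /\ (forall m, pal_prefix w m <-> exists i, n i = m).

Definition delta_is (R : realType) (A : Type) (w : nat -> A) (x : \bar R) : Prop :=
  (inf_pal_prefixes w /\
     exists n, pal_enum w n /\
       x = limn_esup (fun i => (((n i.+1)%:R / (n i)%:R : R)%:E)))
  \/ (~ inf_pal_prefixes w /\ x = +oo%E).

Definition abundant (A : Type) (w : nat -> A) : Prop :=
  inf_pal_prefixes w /\
  exists n, pal_enum w n /\ forall i, (n i.+1 <= 2 * n i + 1)%N.

Definition Dset (R : realType) : set (\bar R) :=
  [set x | exists (A : Type) (w : nat -> A), delta_is w x].

Definition D0set (R : realType) : set (\bar R) :=
  [set x | exists (A : Type) (w : nat -> A), abundant w /\ delta_is w x].
Arguments Dset R : clear implicits.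
Arguments D0set R : clear implicits.

(* Main.v *)
(** If [n_(i+1) <= 2 n_i] then [2 n_i - n_(i+1)] is again the length of a
    palindromic prefix, so palindromic prefixes and periods determine each other.

    Suppose [delta(w) < 2], and let [n_T] come right after the last jump
    [n_T > 2 n_(T-1)]. Start a binary word with the palindrome
    [0^(n_T) 1 0^(n_T)], of length [2 n_T + 1], and extend it by successive
    palindromes of lengths [2 n_i + 1], [i >= T]. The prefixes [n_j], [j < T],
    that the extension refers to have become powers of [0], because
    [2 n_j + 1 <= n_T]; hence the extension is consistent. A palindromic prefix
    other than [0^l], [l <= n_T], and these ones would give a proper divisor of
    [2 (n_(i+1) - n_i)] that is a period of the prefix of length
    [2 n_(i+1) + 1]; by Fine-Wilf it descends to [i = T], where it contradicts
    the isolated letter [1]. The new word is therefore abundant, and it has the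
    same [delta].

    For [delta = 2 + c] with [c >= 0], iterate [p -> p b^k p] with a fresh
    letter [b] and [k] close to [c |p|]; with [c = 0] and [k = 1] the word is
    abundant. *)
Require Import Defs.
From mathcomp Require Import all_boot all_order all_algebra.
From mathcomp Require Import all_classical all_reals all_analysis.
From mathcomp Require Import zify lra ring.
Set Implicit Arguments. Unset Strict Implicit. Unset Printing Implicit Defensive.
Import Order.TTheory GRing.Theory Num.Theory.
Local Open Scope classical_set_scope.

(** * Palindromic prefixes and periods *)

(** Each letter is prescribed or copied from an earlier position; [go] recurses on fuel, which no
    longer affects the value once it exceeds [m]. *)
Lemma word_rec (A : Type) (stop : pred nat) (base : nat -> A) (f : nat -> nat) :
  (forall m, ~~ stop m -> f m < m) ->
  exists w : nat -> A, forall m, w m = if stop m then base m else w (f m).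
Proof.
move=> ltf.
pose go := fix go k m := if k is k'.+1 then
  if stop m then base m else go k' (f m) else base m.
have goE k : forall k' m, m < k -> m < k' -> go k m = go k' m.
  elim: k => [//|k IH] [//|k'] m lemk lemk' /=.
  case: ifPn => // /ltf ltfm; apply: IH; lia.
have goS k m : go k.+1 m = if stop m then base m else go k (f m) by [].
exists (fun m => go m.+1 m) => m; rewrite goS.
by case: ifPn => // /ltf ltfm; apply: goE.
Qed.

Lemma ltn_succ_mono (n : nat -> nat) :
  (forall i, n i < n i.+1) -> {mono n : i j / i <= j}.
Proof. by move=> n_lt; apply: leq_mono; apply: homo_ltn => //; apply: ltn_trans. Qed.

Lemma strict_locate (n : nat -> nat) : (forall i, n i < n i.+1) ->
  forall m, n 0 <= m -> exists i, n i <= m < n i.+1.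
Proof.
move=> n_lt; elim=> [|m IH] n0m.
  by exists 0; have := n_lt 0; lia.
case: (leqP (n 0) m) => [/IH [i /andP [le_i lt_i]]|lt0]; last first.
  by exists 0; have := n_lt 0; lia.
case: (ltnP m.+1 (n i.+1)) => H; first by exists i; lia.
by exists i.+1; have := n_lt i.+1; lia.
Qed.

Lemma strict_block_inj (n : nat -> nat) : (forall i, n i < n i.+1) ->
  forall i j m, n i <= m < n i.+1 -> n j <= m < n j.+1 -> i = j.
Proof.
move=> n_lt i j m /andP [i1 i2] /andP [j1 j2].
have n_mono := ltn_succ_mono n_lt; apply/eqP; rewrite eqn_leq.
by apply/andP; split; rewrite -ltnS ltnNge -n_mono -ltnNge; lia.
Qed.

Lemma pal_prefix0 (A : Type) (w : nat -> A) : pal_prefix w 0.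
Proof. by []. Qed.

Lemma pal_enum0 (A : Type) (w : nat -> A) n : pal_enum w n -> n 0 = 0.
Proof.
case=> n_lt nP; have [i ni] := (nP 0).1 (pal_prefix0 w).
by have := ltn_succ_mono n_lt 0 i; lia.
Qed.

Lemma pal_enum_le (A : Type) (w : nat -> A) n n' i :
  pal_enum w n -> pal_enum w n' -> n i <= n' i.
Proof.
move=> nE n'E; have [n_lt nP] := nE; have [n'_lt n'P] := n'E.
elim: i => [|i IH]; first by rewrite (pal_enum0 nE).
have [j nj] := (nP (n' i.+1)).1 ((n'P _).2 (ex_intro _ i.+1 erefl)).
by rewrite -nj (ltn_succ_mono n_lt) ltnNge -(ltn_succ_mono n_lt) nj -ltnNge;
  have := n'_lt i; lia.
Qed.

Lemma pal_enum_unique (A : Type) (w : nat -> A) n n' :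
  pal_enum w n -> pal_enum w n' -> n =1 n'.
Proof. by move=> nE n'E i; apply/eqP; rewrite eqn_leq !(@pal_enum_le _ w). Qed.

Lemma pal_enum_inf (A : Type) (w : nat -> A) n :
  pal_enum w n -> inf_pal_prefixes w.
Proof.
move=> [n_lt nP] N; exists (n N); split; last by apply/nP; exists N.
by elim: N => // N IH; apply: leq_ltn_trans IH (n_lt N).
Qed.

Definition has_period (A : Type) (w : nat -> A) (l p : nat) : Prop :=
  forall k, k < l -> w k = w (k %% p).

Lemma has_period_shift (A : Type) (w : nat -> A) l p : 0 < p ->
  (forall k, k + p < l -> w (k + p) = w k) <-> has_period w l p.
Proof.
move=> p_gt0; split=> [shift k|per k lt_kp]; last first.
  by rewrite per // [RHS]per ?modnDr //; lia.
have [N] := ubnP k; elim: N k => // N IH k le_kN lt_kl.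
case: (ltnP k p) => [lt_kp|le_pk]; first by rewrite modn_small.
rewrite -(subnK le_pk) modnDr shift; last by lia.
by apply: IH; lia.
Qed.

Lemma has_period_le (A : Type) (w : nat -> A) l l' p :
  l' <= l -> has_period w l p -> has_period w l' p.
Proof. by move=> le_l per k lt_k; apply: per; lia. Qed.

Lemma has_period_dvd (A : Type) (w : nat -> A) l l' p g :
  0 < p -> p <= l' -> g %| p -> has_period w l' g -> has_period w l p ->
  has_period w l g.
Proof.
move=> p_gt0 le_pl' g_p perg perp k lt_kl.
rewrite perp // perg ?modn_dvdm //.
by apply: leq_trans le_pl'; rewrite ltn_mod.
Qed.

(* A weak form of the Fine-Wilf theorem, by the subtractive Euclidean algorithm. *)
Lemma has_period_gcd (A : Type) (w : nat -> A) l p q :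
  0 < p -> 0 < q -> p + q <= l ->
  has_period w l p -> has_period w l q -> has_period w l (gcdn p q).
Proof.
have [N] := ubnP (p + q); elim: N l p q => // N IH l p q le_N p0 q0 le_l.
wlog lt_pq : p q p0 q0 le_N le_l / p <= q => [thm|] perp perq.
  case: (leqP p q) => [|/ltnW] le_pq; first by apply: thm.
  by rewrite gcdnC; apply: thm => //; lia.
case: (eqVneq p q) perq => [<- _|ne_pq perq]; first by rewrite gcdnn.
have gE : gcdn p q = gcdn p (q - p).
  by rewrite -{1}(subnK lt_pq) gcdnDr.
(* Induction handles [p] and [q - p] on the prefix of length [l - p]; period [p] then carries the
   result to length [l]. *)
apply: (@has_period_dvd _ _ _ (l - p) p) => //; first lia.
  by rewrite dvdn_gcdl.
rewrite gE; apply: IH; try lia.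
  by apply: has_period_le perp; lia.
apply/has_period_shift; first lia.
move=> k lt_k.
have perp' := (has_period_shift w l p0).2 perp.
have perq' := (has_period_shift w l q0).2 perq.
rewrite -perp'; last by lia.
have -> : k + (q - p) + p = k + q by lia.
by apply: perq'; lia.
Qed.

(** Composing the two reversals gives the translation by [m - l]. *)
Lemma pal_pal_period (A : Type) (w : nat -> A) l m :
  l < m -> pal_prefix w l -> pal_prefix w m -> has_period w m (m - l).
Proof.
move=> lt_lm pal_l pal_m; apply/has_period_shift; first lia.
move=> k lt_k; rewrite pal_m // [RHS]pal_l; last by lia.
by congr w; lia.
Qed.

Lemma pal_period_pal (A : Type) (w : nat -> A) m p :
  0 < p <= m -> pal_prefix w m -> has_period w m p -> pal_prefix w (m - p).
Proof.
move=> /andP [p0 le_pm] pal_m /(has_period_shift w m p0).2 per k lt_k.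
rewrite -per; last by lia.
by rewrite pal_m; [congr w; lia|lia].
Qed.

(** The gap [n i.+1 - n i] is a period and is at most [n i], so cutting it off the palindrome of
    length [n i] leaves a palindrome. *)
Lemma pal_enum_reflect (A : Type) (w : nat -> A) n i :
  pal_enum w n -> n i.+1 <= 2 * n i ->
  exists2 j, j < i & n j = 2 * n i - n i.+1.
Proof.
move=> [n_lt nP] le_i.
have pal_n j : pal_prefix w (n j) by apply/nP; exists j.
have lt_i := n_lt i.
have per := pal_pal_period lt_i (pal_n i) (pal_n i.+1).
have : pal_prefix w (n i - (n i.+1 - n i)).
  apply: pal_period_pal; [lia|exact: pal_n|].
  by apply: has_period_le per; lia.
move=> /nP [j nj]; exists j; last lia.
by rewrite ltnNge -(ltn_succ_mono n_lt) nj; lia.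
Qed.

(** If the earlier gap properly divided the later one, it would be a period of the prefix of length
    [n i.+2]; cutting it off would give a palindrome strictly between two consecutive lengths. *)
Lemma pal_enum_gap_dvd (A : Type) (w : nat -> A) n i :
  pal_enum w n -> n i.+2 <= 2 * n i.+1 ->
  n i.+1 - n i %| n i.+2 - n i.+1 -> n i.+2 - n i.+1 = n i.+1 - n i.
Proof.
move=> [n_lt nP] le_i dvd_d.
have pal_n j : pal_prefix w (n j) by apply/nP; exists j.
have lt0 := n_lt i; have lt1 := n_lt i.+1.
have le_d : n i.+1 - n i <= n i.+2 - n i.+1 by apply: dvdn_leq => //; lia.
apply/eqP; rewrite eqn_leq le_d andbT leqNgt; apply/negP => lt_d.
have per : has_period w (n i.+2) (n i.+1 - n i).
  apply: has_period_dvd dvd_d _ (pal_pal_period lt1 (pal_n _) (pal_n _)).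
  - by lia.
  - by instantiate (1 := n i.+1); lia.
  - by apply: pal_pal_period.
have /nP [j nj] : pal_prefix w (n i.+2 - (n i.+1 - n i)).
  by apply: pal_period_pal => //; lia.
have := ltn_succ_mono n_lt j i.+1; have := ltn_succ_mono n_lt i.+2 j.
by lia.
Qed.

(** * Words with prescribed palindromic prefixes *)

(** Each palindrome is [p i^(k i) p], with [p] the previous one and [i] a new letter. The condition
    [k 0 = 1] leaves no length strictly between [n 0] and [n 1]. *)
Lemma fresh_block_word_exists (n k : nat -> nat) :
  n 0 = 0 -> k 0 = 1 -> (forall i, 0 < k i) ->
  (forall i, n i.+1 = 2 * n i + k i) -> exists w : nat -> nat, pal_enum w n.
Proof.
move=> n0 k0 k_gt0 nS.
have n_lt i : n i < n i.+1 by rewrite nS; have := k_gt0 i; lia.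
have n_mono := ltn_succ_mono n_lt.
have /choice [idx idxP] : forall m, exists i, n i <= m < n i.+1.
  by move=> m; apply: strict_locate => //; rewrite n0.
have idxE i m : n i <= m < n i.+1 -> idx m = i.
  by move=> im; apply: strict_block_inj (idxP m) im.
have f_lt m : ~~ (m < n (idx m) + k (idx m)) -> (n (idx m).+1).-1 - m < m.
  rewrite -leqNgt; have := idxP m; have := nS (idx m).
  by have := k_gt0 (idx m); lia.
have [w wE] := word_rec idx f_lt.
have w_mid i m : n i <= m < n i + k i -> w m = i.
  move=> im; rewrite wE (@idxE i); first by case: ifP => //; lia.
  by have := nS i; lia.
have w_hi i m : n i + k i <= m < n i.+1 -> w m = w ((n i.+1).-1 - m).
  move=> im; rewrite wE (@idxE i); last by have := nS i; lia.
  by case: ifP => //; lia.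
have w_lo i m : m < n i -> w m < i.
  elim: i m => [|i IH] m lt_m; first by lia.
  have := nS i; case: (ltnP m (n i)) => [/IH|le_m]; first by lia.
  case: (ltnP m (n i + k i)) => [lt_mk|le_mk] nSi; first by rewrite (@w_mid i) //; lia.
  by rewrite (@w_hi i); [have := IH ((n i.+1).-1 - m); lia|lia].
have pal_n i : pal_prefix w (n i).
  case: i => [|i] m; first by rewrite n0.
  have := nS i => nSi lt_m.
  case: (leqP (n i + k i) m) => [le_m|lt_mk]; first by rewrite (@w_hi i) //; lia.
  case: (leqP (n i) m) => [le_m|lt_mn]; first by rewrite !(@w_mid i) //; lia.
  rewrite [RHS](@w_hi i); last by lia.
  by congr w; lia.
exists w; split => // m; split; last by case=> i <-.
move=> pal_m; case: (posnP m) => [->|m_gt0]; first by exists 0.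
have [i /andP [le_i lt_i]] : exists i, n i <= m.-1 < n i.+1.
  by apply: strict_locate => //; rewrite n0.
exists i.+1; apply/eqP; rewrite eqn_leq; apply/andP; split; last by lia.
have nSi := nS i; rewrite leqNgt; apply/negP => lt_m.
have i_gt0 : 0 < i by case: i n0 k0 nSi lt_i le_i lt_m => //= -> -> ->; lia.
have n_gt0 : 0 < n i by have := n_mono i 0; lia.
(* A prefix ending inside the block starts with 0 and ends with [i]. One ending later reflects the
   last letter of the block into the first [n i] positions, where all letters are below [i]. *)
case: (leqP m (n i + k i)) => [le_mk|lt_mk].
  have := pal_m 0 m_gt0; rewrite (@w_mid 0) ?n0 ?k0 //.
  by rewrite (@w_mid i); lia.
have lt_j : n i + k i - 1 < m by have := k_gt0 i; lia.
have := pal_m _ lt_j; rewrite (@w_mid i); last by have := k_gt0 i; lia.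
by have := @w_lo i (m.-1 - (n i + k i - 1)); lia.
Qed.

(** Here [a t] is the intended centre of the palindrome of length [2 * a t + 1], and [true] is the
    letter 1. *)
Definition reflected_word (a : nat -> nat) (v : nat -> bool) : Prop :=
  (forall m, m <= 2 * a 0 -> v m = (m == a 0)) /\
  (forall t m, 2 * a t < m <= 2 * a t.+1 -> v m = v (2 * a t.+1 - m)).

Lemma reflected_word_exists (a : nat -> nat) :
  (forall t, a t < a t.+1 <= 2 * a t) -> exists v, reflected_word a v.
Proof.
move=> a_lt; pose N t := 2 * a t + 1.
have N_lt t : N t < N t.+1 by have := a_lt t; rewrite /N; lia.
have /choice [idx idxP] : forall m, exists t, N 0 <= m -> N t <= m < N t.+1.
  move=> m; case: (leqP (N 0) m) => [/(strict_locate N_lt) [t tm]|lt_m].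
    by exists t.
  by exists 0; lia.
(* Reflection in [a t.+1] lowers every position beyond [2 * a t], since [a t.+1 <= 2 * a t]. *)
have f_lt m : ~~ (m < N 0) -> 2 * a (idx m).+1 - m < m.
  by rewrite -leqNgt => /idxP; have := a_lt (idx m); rewrite /N; lia.
have [v vE] := word_rec (fun m => m == a 0) f_lt.
exists v; split=> [m le_m|t m lt_m]; first by rewrite vE /N; case: ifP => //; lia.
have le0t : a 0 <= a t by rewrite (@ltn_succ_mono a) // => s; case/andP: (a_lt s).
rewrite vE; case: ifP => [|_]; first by rewrite /N; lia.
suff -> : idx m = t by [].
apply: (@strict_block_inj N N_lt _ _ m); last by rewrite /N; lia.
by apply: idxP; rewrite /N; lia.
Qed.

Lemma reflected_word_short_pal (a : nat -> nat) (v : nat -> bool) l :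
  reflected_word a v -> l <= a 0 -> pal_prefix v l.
Proof. by move=> [v0 _] le_l k lt_k; rewrite !v0; lia. Qed.

Lemma reflected_word_pal (a : nat -> nat) (v : nat -> bool) :
  (forall t, a t < a t.+1 <= 2 * a t) ->
  (forall t, (exists2 s, s < t & a s = 2 * a t - a t.+1) \/
             2 * (2 * a t - a t.+1) < a 0) ->
  reflected_word a v -> forall t, pal_prefix v (2 * a t).+1.
Proof.
move=> a_lt a_refl vP t; have [v0 vS] := vP.
have [M] := ubnP t; elim: M t => // M IH [|t] lt_t m lt_m /=.
  by rewrite !v0; lia.
have /andP [lt_a le_a] := a_lt t.
have pal_t : pal_prefix v (2 * a t).+1 by apply: IH; lia.
case: (ltnP (2 * a t) m) => [lt_am|le_am]; first by rewrite (vS t) //; lia.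
case: (ltnP (2 * a t) (2 * a t.+1 - m)) => [lt_am'|le_am'].
  by rewrite [RHS](vS t); [congr v; lia|lia].
(* When a position and its mirror image both lie in the old palindrome, reflecting in [a t], in
   [2 * a t - a t.+1], and in [a t] again amounts to reflecting in [a t.+1]. *)
have pal_l : pal_prefix v (2 * (2 * a t - a t.+1)).+1.
  case: (a_refl t) => [[s lt_s <-]|lt_0]; first by apply: IH; lia.
  by apply: reflected_word_short_pal vP _; lia.
rewrite pal_t; last by lia.
rewrite [RHS]pal_t; last by lia.
rewrite pal_l; last by lia.
by congr v; lia.
Qed.

Lemma reflected_word_gap_period (a : nat -> nat) (v : nat -> bool) :
  (forall t, a t < a t.+1 <= 2 * a t) ->
  (forall t, pal_prefix v (2 * a t).+1) ->
  forall t, has_period v (2 * a t.+1).+1 (2 * (a t.+1 - a t)).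
Proof.
move=> a_lt pal_a t; have := a_lt t => lt_a.
have -> : 2 * (a t.+1 - a t) = (2 * a t.+1).+1 - (2 * a t).+1 by lia.
by apply: pal_pal_period => //; lia.
Qed.

(* The gcd of a putative shorter period with the previous gap descends to the
   first gap, where the isolated letter [1] excludes it. *)
Lemma reflected_word_primitive (a : nat -> nat) (v : nat -> bool) :
  (forall t, a t < a t.+1 <= 2 * a t) ->
  (forall t, a t.+1 - a t %| a t.+2 - a t.+1 ->
             a t.+2 - a t.+1 = a t.+1 - a t) ->
  (forall t, pal_prefix v (2 * a t).+1) -> reflected_word a v ->
  forall t h, h %| 2 * (a t.+1 - a t) -> h < 2 * (a t.+1 - a t) ->
  ~ has_period v (2 * a t.+1).+1 h.
Proof.
move=> a_lt a_gap pal_a [v0 _].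
have half_lt d h : 0 < d -> h %| 2 * d -> h < 2 * d -> 0 < h <= d.
  by move=> d0 /dvdnP [[|[|q]] qE] lt_h; nia.
have per_gap := reflected_word_gap_period a_lt pal_a.
elim=> [|t IH] h dvd_h lt_h per_h; have lt_a := a_lt 0.
  have := @half_lt (a 1 - a 0) h; rewrite dvd_h lt_h => /(_ _ isT isT) hP.
  (* The 1 at [a 0] would equal the letter at a position below [h <= a 0], which is 0. *)
  have lt_m : a 0 %% h < h by rewrite ltn_mod; lia.
  have := per_h (a 0); rewrite !v0 ?eqxx; try lia.
have lt_t := a_lt t; have lt_t1 := a_lt t.+1.
have := @half_lt (a t.+2 - a t.+1) h; rewrite dvd_h lt_h => /(_ _ isT isT) hP.
have := IH (gcdn h (2 * (a t.+1 - a t))) (dvdn_gcdr _ _).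
have le_g := dvdn_leq _ (dvdn_gcdr h (2 * (a t.+1 - a t))).
have per_g : has_period v (2 * a t.+1).+1 (gcdn h (2 * (a t.+1 - a t))).
  apply: has_period_gcd; try lia; last exact: per_gap.
  by apply: has_period_le per_h; lia.
case: (ltnP (gcdn h (2 * (a t.+1 - a t))) (2 * (a t.+1 - a t))) => [_|ge_g _].
  by move/(_ isT).
(* If the gcd is not a proper divisor, the earlier gap divides the later one, so they are equal and
   [h] is too large. *)
have gE : gcdn h (2 * (a t.+1 - a t)) = 2 * (a t.+1 - a t) by lia.
have dvd_gh : 2 * (a t.+1 - a t) %| h by rewrite -gE dvdn_gcdl.
have := dvdn_leq _ dvd_gh.
have := dvdn_trans dvd_gh dvd_h; rewrite dvdn_pmul2l // => /a_gap.
by lia.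
Qed.

(** The indices up to [a 0] count the powers of 0, including the empty word. *)
Definition reflected_lengths (a : nat -> nat) (k : nat) : nat :=
  if k <= a 0 then k else (2 * a (k - (a 0).+1)).+1.

Lemma reflected_word_enum (a : nat -> nat) (v : nat -> bool) :
  (forall t, a t < a t.+1 <= 2 * a t) ->
  (forall t, a t.+1 - a t %| a t.+2 - a t.+1 ->
             a t.+2 - a t.+1 = a t.+1 - a t) ->
  (forall t, (exists2 s, s < t & a s = 2 * a t - a t.+1) \/
             2 * (2 * a t - a t.+1) < a 0) ->
  reflected_word a v -> pal_enum v (reflected_lengths a).
Proof.
move=> a_lt a_gap a_refl vP.
have pal_a := reflected_word_pal a_lt a_refl vP.
have prim := reflected_word_primitive a_lt a_gap pal_a vP.
have [v0 _] := vP.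
have ltS t : a t < a t.+1 by case/andP: (a_lt t).
split=> [k|m]; rewrite /reflected_lengths.
  case: (leqP k (a 0)) => le_k; case: (leqP k.+1 (a 0)) => le_k1; try lia.
    by rewrite (_ : k.+1 - (a 0).+1 = 0); lia.
  by rewrite subSn //; have := ltS (k - (a 0).+1); lia.
split=> [pal_m|[k <-]]; last first.
  case: ifP => [le_k|_]; last exact: pal_a.
  exact: reflected_word_short_pal vP le_k.
case: (leqP m (a 0)) => [le_m|lt_m]; first by exists m; rewrite le_m.
suff [t ->] : exists t, m = (2 * a t).+1.
  by exists (t + (a 0).+1); rewrite leqNgt ltn_addl //= addnK.
(* Such a prefix contains a single 1, which is not at its centre. *)
case: (leqP m (2 * a 0)) => [le_m|lt_m0].
  by have := pal_m (a 0) lt_m; rewrite !v0; lia.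
have ltN t : (2 * a t).+1 < (2 * a t.+1).+1 by have := ltS t; lia.
have [t /andP [le_t lt_t]] := strict_locate ltN lt_m0.
exists t; apply/eqP; rewrite eqn_leq le_t andbT leqNgt; apply/negP => lt_tm.
have := a_lt t => /andP [lt_at le_at].
have per_m := pal_pal_period lt_tm (pal_a t) pal_m.
have per_gap := @reflected_word_gap_period a v a_lt pal_a t.
have le_g := dvdn_leq _ (dvdn_gcdl (m - (2 * a t).+1) (2 * (a t.+1 - a t))).
apply: (prim t _ (dvdn_gcdr (m - (2 * a t).+1) _)); first by lia.
(* The gcd is a period of the prefix of length [m]; the period [2 * (a t.+1 - a t)] extends it to
   the whole palindrome. *)
apply: (has_period_dvd _ _ (dvdn_gcdr _ _) (l' := m)) (per_gap); try lia.
apply: has_period_gcd => //; try lia.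
by apply: has_period_le (per_gap); lia.
Qed.

(** A jump exists because [n 0 = 0 < n 1]. *)
Lemma pal_enum_last_jump (A : Type) (w : nat -> A) n M :
  pal_enum w n -> (forall i, M <= i -> n i.+1 <= 2 * n i) ->
  exists T, 2 * n T < n T.+1 /\ forall i, T < i -> n i.+1 <= 2 * n i.
Proof.
move=> nE; elim: M => [|M IH] nM.
  by have := nM 0 isT; have := nE.1 0; rewrite (pal_enum0 nE); lia.
case: (ltnP (2 * n M) (n M.+1)) => [ltM|leM]; first by exists M.
by apply: IH => i; rewrite leq_eqVlt => /orP [/eqP <-|/nM].
Qed.

Lemma pal_enum_reflect_exists (A : Type) (w : nat -> A) n M :
  pal_enum w n -> (forall i, M <= i -> n i.+1 <= 2 * n i) ->
  exists T (v : nat -> bool), (forall i, T <= i -> n i.+1 <= 2 * n i) /\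
    pal_enum v (reflected_lengths (fun t => n (T + t))).
Proof.
move=> nE /(pal_enum_last_jump nE) [T [jump n_le]].
have [n_lt nP] := nE; have n_mono := ltn_succ_mono n_lt.
pose a t := n (T.+1 + t).
have a_lt t : a t < a t.+1 <= 2 * a t.
  by rewrite /a addnS n_lt n_le //; lia.
have a_gap t : a t.+1 - a t %| a t.+2 - a t.+1 ->
               a t.+2 - a t.+1 = a t.+1 - a t.
  by rewrite /a !addnS; apply: pal_enum_gap_dvd nE _; apply: n_le; lia.
have a_refl t : (exists2 s, s < t & a s = 2 * a t - a t.+1) \/
                2 * (2 * a t - a t.+1) < a 0.
  rewrite /a addn0 addnS.
  have [j lt_j <-] := pal_enum_reflect nE (n_le (T.+1 + t) ltac:(lia)).
  (* A length from before the jump satisfies [2 * n j <= 2 * n T < n T.+1 = a 0]. *)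
  case: (leqP j T) => [le_j|lt_Tj]; last first.
    by left; exists (j - T.+1); [lia|congr n; lia].
  by right; have := n_mono j T; lia.
have [v vP] := reflected_word_exists a_lt.
by exists T.+1, v; split=> //; apply: reflected_word_enum.
Qed.

Local Open Scope ring_scope.

(** * Upper limits of ratios *)

Lemma limn_esup_leP (R : realType) (u : nat -> R) (l : R) :
  (limn_esup (fun i => (u i)%:E) <= l%:E)%E <->
  forall e, 0 < e -> exists N, forall i, (N <= i)%N -> u i <= l + e.
Proof.
rewrite limn_esup_lim (cvg_lim _ (@cvg_esups_inf _ _)) //.
split=> [le_l e e_gt0|ev].
  have : (ereal_inf (range (esups (fun i => (u i)%:E))) < (l + e)%:E)%E.
    by apply: le_lt_trans le_l _; rewrite lte_fin ltrDl.
  move=> /ereal_inf_lt [_ [N _ <-] lt_N]; exists N => i le_Ni.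
  rewrite -lee_fin; apply: le_trans (ltW lt_N).
  by apply: ereal_sup_ubound; exists i.
apply/lee_addgt0Pr => e e_gt0; have [N leN] := ev e e_gt0.
apply: (@le_trans _ _ (esups (fun i => (u i)%:E) N)).
  by apply: ereal_inf_lbound; exists N.
by apply: ge_ereal_sup => _ [i le_Ni <-]; rewrite -EFinD lee_fin leN.
Qed.

Lemma eqe_ler (R : realType) (x y : \bar R) :
  (forall l : R, (x <= l%:E)%E <-> (y <= l%:E)%E) -> x = y.
Proof.
suff H : forall x y : \bar R,
    (forall l : R, (y <= l%:E)%E -> (x <= l%:E)%E) -> (x <= y)%E.
  by move=> xy; apply/eqP; rewrite eq_le !H // => l /xy.
move=> {x y} x [y| |] le_xy; [exact: le_xy|exact: leey|].
case: x le_xy => [x| |] // le_xy.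
  by have := le_xy (x - 1)%R (leNye _); rewrite lee_fin => H; exfalso; lra.
by have := le_xy 0%R (leNye _).
Qed.

(** The shifts [K] and [L] align enumerations whose initial segments have different sizes. *)
Lemma limn_esup_close (R : realType) (u v : nat -> R) (K L : nat) :
  (forall e, 0 < e -> exists N, forall i, (N <= i)%N ->
     `|u (i + K)%N - v (i + L)%N| <= e) ->
  limn_esup (fun i => (u i)%:E) = limn_esup (fun i => (v i)%:E).
Proof.
suff H : forall (u v : nat -> R) (K L : nat),
    (forall e, 0 < e -> exists N, forall i, (N <= i)%N ->
       `|u (i + K)%N - v (i + L)%N| <= e) ->
    forall l : R, (limn_esup (fun i => (u i)%:E) <= l%:E)%E ->
    (limn_esup (fun i => (v i)%:E) <= l%:E)%E.
  move=> uv; apply: eqe_ler => l; split; first exact: H uv l.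
  apply: (H _ _ L K) => e /uv [N leN]; exists N => i /leN.
  by rewrite distrC.
move=> {u v K L} u v K L uv l /limn_esup_leP ul; apply/limn_esup_leP => e e_gt0.
have e2 : 0 < e / 2 by lra.
have [N1 le1] := uv _ e2; have [N2 le2] := ul _ e2.
exists (N1 + N2 + L)%N => i le_i.
have := le1 (i - L)%N ltac:(lia); have := le2 (i - L + K)%N ltac:(lia).
rewrite subnK; last by lia.
by rewrite ler_norml => ? /andP []; lra.
Qed.

(** All ratio estimates below have error at most [1 / n i]; passing to large [i] also avoids the
    default value of division by [n 0 = 0]. *)
Lemma strict_inv_small (R : realType) (n : nat -> nat) :
  (forall i, (n i < n i.+1)%N) ->
  forall e : R, 0 < e -> exists N, forall i, (N <= i)%N ->
    (0 < n i)%N /\ (n i)%:R^-1 <= e.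
Proof.
move=> n_lt e e_gt0; have n_ge i : (i <= n i)%N.
  by elim: i => // i IH; apply: leq_ltn_trans IH (n_lt i).
exists (Num.truncn e^-1).+1 => i le_i; have le_n := leq_trans le_i (n_ge i).
split; first by lia.
have lt_e : e^-1 < (n i)%:R.
  by apply: lt_le_trans (truncnS_gt _) _; rewrite ler_nat.
by rewrite invf_ple ?ltW ?posrE //; apply: lt_trans lt_e; rewrite invr_gt0.
Qed.

Lemma abundant_limsup_le2 (R : realType) (n : nat -> nat) :
  (forall i, n i < n i.+1)%N -> (forall i, n i.+1 <= 2 * n i + 1)%N ->
  (limn_esup (fun i => (((n i.+1)%:R / (n i)%:R : R)%:E)) <= 2%:E)%E.
Proof.
move=> n_lt n_le; apply/limn_esup_leP => e /(strict_inv_small n_lt) [N leN].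
exists N => i /leN [ni_gt0 inv_le].
have n0 : 0 < (n i)%:R :> R by rewrite ltr0n.
apply: (@le_trans _ _ (2 + (n i)%:R^-1)); last by lra.
rewrite ler_pdivrMr // mulrDl mulVf ?gt_eqF //.
by rewrite -natrM natr1 ler_nat; have := n_le i; lia.
Qed.

Lemma limsup_lt2 (R : realType) (n : nat -> nat) :
  (forall i, n i < n i.+1)%N ->
  (limn_esup (fun i => (((n i.+1)%:R / (n i)%:R : R)%:E)) < 2%:E)%E ->
  exists M, forall i, (M <= i)%N -> (n i.+1 <= 2 * n i)%N.
Proof.
move=> n_lt; set x := limn_esup _ => lt_x.
have [l lt_l le_l] : exists2 l : R, l < 2 & (x <= l%:E)%E.
  case: x lt_x => [x| |] //; first by rewrite lte_fin => lt_x; exists x.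
  by move=> _; exists 0; rewrite ?leNye //; lra.
have e_gt0 : 0 < 2 - l by lra.
have [N leN] := (limn_esup_leP _ _).1 le_l _ e_gt0.
exists N.+1 => i le_i; have := leN i ltac:(lia).
have ni_gt0 : (0 < n i)%N by have := n_lt i.-1; rewrite prednK; lia.
rewrite ler_pdivrMr ?ltr0n // (_ : l + (2 - l) = 2); last by lra.
by rewrite -natrM ler_nat.
Qed.

Lemma ratio_affine_close (R : realType) (x y : R) :
  0 < x -> x <= y -> y <= 2 * x ->
  `|(2 * y + 1) / (2 * x + 1) - y / x| <= x^-1.
Proof.
move=> x0 xy yx.
have -> : (2 * y + 1) / (2 * x + 1) - y / x = - ((y - x) / (x * (2 * x + 1))).
  by field; rewrite !gt_eqF //; lra.
have d0 : 0 < x * (2 * x + 1) by rewrite mulr_gt0 //; lra.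
rewrite normrN ger0_norm; last by rewrite divr_ge0 //; lra.
rewrite ler_pdivrMr // mulKf ?gt_eqF //; lra.
Qed.

Lemma fresh_block_ratio_close (R : realType) (c x k : R) :
  0 < x -> c * x <= k -> k <= c * x + 1 ->
  `|(2 * x + k) / x - (2 + c)| <= x^-1.
Proof.
move=> x0 le_k ge_k.
have -> : (2 * x + k) / x - (2 + c) = (k - c * x) / x.
  by field; rewrite gt_eqF.
rewrite ger0_norm; last by rewrite divr_ge0 //; lra.
by rewrite ler_pdivrMr // mulVf ?gt_eqF //; lra.
Qed.

Lemma limn_esup_cst (R : realType) (c : R) :
  limn_esup (fun _ : nat => c%:E) = c%:E.
Proof.
apply: eqe_ler => l; split=> [/limn_esup_leP le_l|le_l].
  by apply/lee_addgt0Pr => e /le_l [N /(_ N (leqnn N))].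
by apply/limn_esup_leP => e e_gt0; exists 0%N => i _; move: le_l; rewrite lee_fin; lra.
Qed.

(** * Realizing the values of delta *)

Lemma fresh_block_delta (R : realType) (c : R) : 0 <= c ->
  exists w : nat -> nat, delta_is w (2 + c)%:E /\ (c = 0 -> abundant w).
Proof.
(* Rounding gives [c * x <= k x <= c * x + 1] with a nonempty block; for [c = 0] the lengths satisfy
   [n i.+1 = 2 * n i + 1]. *)
move=> c_ge0; pose k x := (Num.truncn (c * x%:R)).+1.
pose n i := iter i (fun x => 2 * x + k x)%N 0%N.
have nS i : (n i.+1 = 2 * n i + k (n i))%N by [].
have k0 : k 0%N = 1%N by rewrite /k mulr0 truncn0.
have [w wE] : exists w : nat -> nat, pal_enum w n.
  exact: (@fresh_block_word_exists n (k \o n)).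
have n_lt := wE.1; have w_inf := pal_enum_inf wE.
exists w; split; last first.
  move=> c0; split=> //; exists n; split=> // i.
  by rewrite nS /k c0 mul0r truncn0.
left; split=> //; exists n; split=> //.
rewrite -limn_esup_cst; apply/esym.
apply: (limn_esup_close (K := 0) (L := 0)) => e /(strict_inv_small n_lt) [N leN].
exists N => i /leN [ni_gt0 le_e]; apply: le_trans le_e.
rewrite !addn0 nS natrD natrM; apply: fresh_block_ratio_close.
- by rewrite ltr0n.
- by rewrite ltW // truncnS_gt.
- by rewrite /k -natr1 lerD2r truncn_le // mulr_ge0.
Qed.

Lemma delta_lt2_abundant (R : realType) (A : Type) (w : nat -> A) (x : \bar R) :
  delta_is w x -> (x < 2%:E)%E -> D0set R x.
Proof.
case=> [[w_inf [n [nE ->]]]|[_ ->] //] lt_x.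
have [M nM] := limsup_lt2 nE.1 lt_x.
have [T [v [n_le vE]]] := pal_enum_reflect_exists nE nM.
exists bool, v; set a := reflected_lengths _ in vE.
have v_inf := pal_enum_inf vE; split.
  split=> //; exists a; split=> // i.
  (* The passage from [n T] to [2 * n T + 1] meets the abundance bound with equality. *)
  rewrite /a /reflected_lengths addn0.
  case: (leqP i (n T)) => le_i; case: (leqP i.+1 (n T)) => le_i1; try lia.
    by rewrite (_ : i.+1 - (n T).+1 = 0)%N ?addn0; lia.
  rewrite subSn // addnS; have := n_le (T + (i - (n T).+1))%N; lia.
left; split=> //; exists a; split=> //.
(* Skipping the [n T + 1] powers of 0 matches [2 * n (i + T) + 1] with [n (i + T)]. *)
apply: (limn_esup_close (K := T) (L := (n T).+1)).
move=> e /(strict_inv_small nE.1) [N leN].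
exists N => i le_i.
have [ni_gt0 le_e] := leN (i + T)%N ltac:(lia); apply: le_trans le_e.
rewrite distrC /a /reflected_lengths addn0 !(leqNgt _ (n T)).
rewrite -addSn !ltn_addl //= !addnK addnS addnC.
rewrite -natr1 -[X in _ / X - _]natr1 !natrM.
have := n_le (i + T)%N ltac:(lia); rewrite -(ler_nat R) natrM => n_le_i.
apply: ratio_affine_close => //; first by rewrite ltr0n.
by rewrite ler_nat ltnW // nE.1.
Qed.

Lemma delta_infty (R : realType) : Dset R +oo%E.
Proof.
(* In the word 1000..., no prefix of length at least 2 is a palindrome. *)
exists bool, (fun k => k == 0%N); right; split=> // /(_ 2%N) [m [le_m]].
by move=> /(_ 0%N ltac:(lia)); rewrite subn0 eqxx; lia.
Qed.

Theorem theorem1p2 (R : realType) :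
  Dset R = D0set R `|` [set x : \bar R | (2%:E < x)%E] /\
  D0set R `&` [set x : \bar R | (2%:E < x)%E] = set0.
Proof.
split; apply/seteqP; split=> x.
- move=> [A [w wx]] /=; case: (ltgtP x 2%:E) => [lt_x|lt_x|->].
  + by left; apply: delta_lt2_abundant wx lt_x.
  + by right.
  + have [v [v2 v_ab]] := fresh_block_delta (lexx (0 : R)).
    by left; exists nat, v; split; [exact: v_ab|rewrite addr0 in v2].
- case=> [[A [w [_ wx]]]|/=]; first by exists A, w.
  case: x => [x| |] // lt_x; last exact: delta_infty.
  have [|w [wx _]] := @fresh_block_delta R (x - 2).
    by rewrite lte_fin in lt_x; lra.
  by exists nat, w; rewrite (_ : x = 2 + (x - 2)) //; lra.
- case=> [[A [w [[w_inf [n [nE n_le]]] wx]]]] /=.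
  case: wx => [[_ [n' [n'E ->]]]|[]//].
  rewrite (funext (pal_enum_unique n'E nE)) ltNge.
  by rewrite (abundant_limsup_le2 _ nE.1 n_le).
- by [].
Qed.
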